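(* Let $G$ be a Lie group with Lie algebra $\mathcal{L}$, inner product $\mathbf{I}$ on $\mathcal{L}$ and induced left invariant Riemannian metric $\mathbf{G}$. Assume hypothesis H1 (see context) holds for $\mathcal{N}_b=\{g\in G:v(g)<b\}\subset G$, and let $g^0\in\mathcal{N}_b$, for the hybrid optimal control problem with the performance function $v:G\to\mathbb{R}$. Run the EG-HMP algorithm (see context) from $g^0$ with tolerance $\beta>0$. Then there exists a single finite $k=k(\beta)$ at which the algorithm stops, and either (i) $0<\mathbf{I}\big(TL_{(g^k)^{-1}}\nabla v(g^k),TL_{(g^k)^{-1}}\nabla v(g^k)\big)<\beta$, or (ii) $\mathbf{I}\big(TL_{(g^k)^{-1}}\nabla v(g^k),TL_{(g^k)^{-1}}\nabla v(g^k)\big)=0$, in which case the Exp-Gradient flow $\varphi(\cdot,g^0)$ reaches an equilibrium after a finite number of switchings, and hence $\nabla v(g^{k(\beta)}(\beta))=0$ and $g^{k(\beta)}(\beta)=g_*$, where $g_*$ is the unique point of $\mathcal{N}_b\subset G$ such that $\|\nabla v(g_* )\|=0$. In either case, the point $g^{k(\beta)}(\beta)$ at which the algorithm stops is such that $$g^{k(\beta)}(\beta)\to g_*,\qquad k(\beta)\to\infty,\qquad\text{as }\beta\to0.$$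
   Context: Notation. $\star$ is the group operation of $G$, $L_g(h)=g\star h$, $TL_g$ is its tangent map, $\exp:\mathcal{L}\to G$ the Lie group exponential. $\mathbf{G}(g)(X,Y)=\mathbf{I}(TL_{g^{-1}}X,TL_{g^{-1}}Y)$. The function $v:G\to\mathbb{R}$ is the performance (value) function of an optimal control problem for a left invariant hybrid system on $G$ with two distinct discrete states; it has differential $dv|_g=\partial v/\partial g\in T_g^*G$, and its gradient $\nabla v$ is defined by $\langle dv,X_g\rangle=\mathbf{G}(g)(\nabla v,X_g)$ for all $X_g\in T_gG$. Exp-Gradient flow. Set $\theta^0=0$ and start from $g^0\in G$. For each $k\ge0$ with $TL_{(g^k)^{-1}}\nabla v(g^k)\ne0$ put $$g^k(\theta):=g^k\star\exp\big(-(\theta-\theta^k)\,TL_{(g^k)^{-1}}\nabla v(g^k)\big),\qquad \theta\in[\theta^k,\theta^{k+1}),$$ where $$\theta^{k+1}=\sup_s\Big\{s\in[\theta^k,\theta^k+1):\ \tfrac{d}{dt}v(g^k(t))\le0\ \text{ for all }t\in[\theta^k,s)\Big\},$$ and $g^{k+1}:=g^k(\theta^{k+1})$ (the same formula evaluated at $\theta^{k+1}$). If $\nabla v(g^k)=0$ the flow has reached an equilibrium. The concatenation of these curves is the flow $\varphi(\theta,g^0)$; the $\theta^k$ are its switching times. EG-HMP algorithm with tolerance $\beta>0$. Start with $k=0$ and $g^0$. At step $k$ compute $\nabla v(g^k)$; if $\mathbf{I}(TL_{(g^k)^{-1}}\nabla v(g^k),TL_{(g^k)^{-1}}\nabla v(g^k))<\beta$,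 stop; otherwise compute $\theta^{k+1}$ and $g^{k+1}$ exactly as in the Exp-Gradient flow, replace $k$ by $k+1$, and repeat. The index at which it stops is $k(\beta)$ and the corresponding point is $g^{k(\beta)}(\beta)$. Hypothesis H1. There exists $0<b<\infty$ such that $\mathcal{N}_b=\{g\in G:v(g)<b\}$ (i) is open, (ii) is connected, (iii) contains a strict local minimum $g_*$ of $v$ which is the only local minimum in $\mathcal{N}_b$, (iv) has compact closure, and (v) satisfies $\mathcal{N}_{g_*}\subset\mathcal{N}_b$, where $\mathcal{N}_{g_*}$ is a neighbourhood of $g_*$.
   Formalization: Formally, v is assumed C¹, g_* is assumed to be the only point of N_b with zero gradient norm (H1 does not imply this), and k(β)→∞ is claimed only when the flow does not reach an equilibrium after finitely many switchings (it fails in case (ii)). *)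

(* Defs.v *)
From HB Require Import structures.
From mathcomp Require Import all_boot all_order all_algebra.
From mathcomp Require Import all_classical all_reals all_analysis.

Set Implicit Arguments.
Unset Strict Implicit.
Unset Printing Implicit Defensive.

Import Order.TTheory GRing.Theory Num.Theory.
Import numFieldNormedType.Exports.

Local Open Scope classical_set_scope.
Local Open Scope ring_scope.

(* [Ck k A f]: f is of class C^k on the open subset A of V. The derivative Df is
   of class C^k iff all the maps x |-> Df(x) u are, because this is only used
   with V finite-dimensional. *)
Fixpoint Ck (R : realType) (V W : normedModType R) (k : nat)
    (A : set V) (f : V -> W) : Prop :=
  (forall x, A x -> {for x, continuous f}) /\
  if k is k'.+1 then
    (forall x, A x -> differentiable f x) /\
    (forall u : V, Ck k' A (fun x => 'd f x u))
  else True.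

Definition smooth_on (R : realType) (V W : normedModType R)
    (A : set V) (f : V -> W) : Prop :=
  open A /\ forall k, Ck k A f.

(* A chart, given by its domain, its coordinate map and the inverse [param] of
   the latter; [coord] and [param] are total, but meaningless outside of [dom]
   and [coord @` dom] respectively. *)
Record chart (R : realType) (n : nat) (T : topologicalType) := Chart {
  dom : set T;
  coord : T -> 'rV[R]_n;
  param : 'rV[R]_n -> T }.

Definition chart_codom (R : realType) n (T : topologicalType) (c : chart R n T) :
  set 'rV[R]_n := coord c @` dom c.

Definition is_chart (R : realType) n (T : topologicalType) (c : chart R n T) :=
  [/\ open (dom c), open (chart_codom c),
      (forall x, dom c x -> param c (coord c x) = x),
      (forall x, dom c x -> {for x, continuous (coord c)}) &
      (forall y, chart_codom c y -> {for y, continuous (param c)})].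

(* The smooth structure is given by an atlas {chart_at g | g}, where chart_at g
   is a preferred chart around g. A tangent vector at g is represented by its
   coordinates in the preferred chart at g, so that every T_g G is 'rV[R]_n; in
   particular the Lie algebra, as a vector space, is T_1 G = 'rV[R]_n. *)
HB.mixin Record isLieGroup (R : realType) (n : nat) G
    of Topological G & Group G := {
  lie_hausdorff : hausdorff_space G;
  lie_second_countable : @second_countable G;
  chart_at : G -> chart R n G;
  chart_atP : forall g, is_chart (chart_at g);
  mem_chart_at : forall g, dom (chart_at g) g;
  chart_transition : forall g h,
    smooth_on (coord (chart_at g) @` (dom (chart_at g) `&` dom (chart_at h)))
      (coord (chart_at h) \o param (chart_at g));
  lie_mul_continuous : continuous (fun z : G * G => (z.1 * z.2)%g);
  lie_mul_smooth : forall g h k,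
    smooth_on
      [set z : 'rV[R]_n * 'rV[R]_n |
        [/\ chart_codom (chart_at g) z.1, chart_codom (chart_at h) z.2 &
            dom (chart_at k)
              (param (chart_at g) z.1 * param (chart_at h) z.2)%g]]
      (fun z => coord (chart_at k)
                  (param (chart_at g) z.1 * param (chart_at h) z.2)%g);
  lie_inv_continuous : continuous (fun x : G => (x^-1)%g);
  lie_inv_smooth : forall g h,
    smooth_on
      [set y | chart_codom (chart_at g) y /\
               dom (chart_at h) ((param (chart_at g) y)^-1)%g]
      (fun y => coord (chart_at h) ((param (chart_at g) y)^-1)%g) }.

#[short(type="lieGroupType")]
HB.structure Definition LieGroup (R : realType) (n : nat) :=
  {G of isLieGroup R n G & Topological G & Group G}.

Section LieGroupCalculus.
Variables (R : realType) (n : nat) (G : lieGroupType R n).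
Implicit Types (v : G -> R) (g h : G) (X Y : 'rV[R]_n).

Local Notation chart_at := (@chart_at R n G).

Definition tangent_map (f : G -> G) g : 'rV[R]_n -> 'rV[R]_n :=
  'd (coord (chart_at (f g)) \o f \o param (chart_at g))
     (coord (chart_at g) g).

(* The tangent map T_g L_h : T_g G -> T_(h g) G of the left translation. *)
Definition TL h g : 'rV[R]_n -> 'rV[R]_n := tangent_map (fun x => h * x)%g g.

Definition C1 v : Prop :=
  forall g, Ck 1 (chart_codom (chart_at g)) (v \o param (chart_at g)).

Definition differential v g : 'rV[R]_n -> R :=
  'd (v \o param (chart_at g)) (coord (chart_at g) g).

Definition smooth_curve (c : R -> G) : Prop :=
  continuous c /\
  forall g, smooth_on (c @^-1` dom (chart_at g)) (coord (chart_at g) \o c).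

Definition velocity (c : R -> G) (t : R) : 'rV[R]_n :=
  derive1 (coord (chart_at (c t)) \o c) t.

Definition one_parameter_subgroup (c : R -> G) : Prop :=
  smooth_curve c /\ forall s t : R, c (s + t) = (c s * c t)%g.

(* The homomorphism property forces exp (0 *: X) = 1, so that this velocity is
   indeed in T_1 G; exp X is the value at time 1 of the subgroup. *)
Definition is_lie_exp (exp : 'rV[R]_n -> G) : Prop :=
  forall X, one_parameter_subgroup (fun t => exp (t *: X)) /\
            velocity (fun t => exp (t *: X)) 0 = X.

Section Metric.
Variable I : {dot 'rV[R]_n for idfun}.

Definition left_invariant_metric g X Y : R := I (TL g^-1%g g X) (TL g^-1%g g Y).

(* The Riesz representative of the differential; it exists and is unique at
   every point where v is differentiable. *)
Definition gradient v g : 'rV[R]_n :=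
  xget 0 [set Y | forall X, differential v g X = left_invariant_metric g Y X].

Definition gradient_norm v g : R :=
  Num.sqrt (left_invariant_metric g (gradient v g) (gradient v g)).

Definition left_gradient v g : 'rV[R]_n := TL g^-1%g g (gradient v g).

Definition left_gradient_sq v g : R := I (left_gradient v g) (left_gradient v g).

Section ExpGradientFlow.
Variables (exp : 'rV[R]_n -> G) (v : G -> R).

(* The curve starting at g at time t0; the formula makes sense for all t. *)
Definition eg_curve g (t0 t : R) : G :=
  (g * exp (- (t - t0) *: left_gradient v g))%g.

Definition eg_next_time g (t0 : R) : R :=
  sup [set s | t0 <= s < t0 + 1 /\
               forall t, t0 <= t < s -> derive1 (v \o eg_curve g t0) t <= 0].

Definition eg_step (z : G * R) : G * R :=
  if left_gradient v z.1 == 0 then z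
  else (eg_curve z.1 z.2 (eg_next_time z.1 z.2), eg_next_time z.1 z.2).

(* The points g^k and the switching times theta^k. *)
Definition eg_point g0 (k : nat) : G := (iter k eg_step (g0, 0)).1.
Definition eg_time g0 (k : nat) : R := (iter k eg_step (g0, 0)).2.

(* [eg_flow g0 t h] means phi(t, g0) = h. Once an equilibrium is reached, the
   flow stays there forever. *)
Definition eg_flow g0 (t : R) h : Prop :=
  exists k, if left_gradient v (eg_point g0 k) == 0
    then eg_time g0 k <= t /\ h = eg_point g0 k
    else eg_time g0 k <= t < eg_time g0 k.+1 /\
         h = eg_curve (eg_point g0 k) (eg_time g0 k) t.

Definition eg_flow_reaches_equilibrium g0 : Prop :=
  exists k, gradient v (eg_point g0 k) = 0 /\
    forall t, eg_time g0 k <= t -> eg_flow g0 t (eg_point g0 k).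

(* The points computed by the algorithm are those of the flow, until the first
   index at which the stopping test succeeds. *)
Definition eg_hmp_stops_at g0 (beta : R) (k : nat) : Prop :=
  left_gradient_sq v (eg_point g0 k) < beta /\
  forall j, (j < k)%N -> ~ left_gradient_sq v (eg_point g0 j) < beta.

End ExpGradientFlow.
End Metric.

Definition sublevel v (b : R) : set G := [set g | v g < b].

Definition local_min v g : Prop := \forall h \near g, v g <= v h.

Definition strict_local_min v g : Prop :=
  \forall h \near g, h != g -> v g < v h.

Definition hypothesis_H1 v (b : R) (gs : G) : Prop :=
  0 < b /\
  [/\ open (sublevel v b),
      connected (sublevel v b),
      [/\ sublevel v b gs, strict_local_min v gs &
          forall g, sublevel v b g -> local_min v g -> g = gs],
      compact (closure (sublevel v b)) &
      exists2 U, nbhs gs U & U `<=` sublevel v b].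

End LieGroupCalculus.

(* Main.v *)
(* Write xi(g) for the left translate to the Lie algebra of the gradient of v at
   g. The derivative of v along t |-> g exp(tX) is I(xi(g exp(tX)), X), and xi is
   continuous because v is C^1 and the multiplication is smooth. Hence if
   xi(h) <> 0, a step of the flow from any g close to h lowers v by at least a
   fixed d > 0: this needs exp(sX) to stay close to 1 for small s, uniformly in
   bounded X, which follows from a speed bound in a chart at 1.
   The points g^k stay in the sublevel set, whose closure is compact. If h is a
   cluster point of (g^k), then v(h) <= v(g^k) for all k, so the fixed decrease
   near h is impossible and xi(h) = 0; thus h = g_*, the only cluster point, and
   g^k tends to g_*. So xi(g^k) tends to 0, the algorithm stops, and for small
   beta it cannot stop among the first N points except at an equilibrium. *)
Require Import Defs.
From HB Require Import structures.
From mathcomp Require Import all_boot all_order all_algebra.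
From mathcomp Require Import all_classical all_reals all_analysis.

Set Implicit Arguments.
Unset Strict Implicit.
Unset Printing Implicit Defensive.

Import Order.TTheory GRing.Theory Num.Theory.
Import numFieldNormedType.Exports.

Local Open Scope classical_set_scope.
Local Open Scope ring_scope.

(* [vector.coord] hides the chart field [coord]. *)
Local Notation coord := Defs.coord.

(** * Differentials of maps known only near a point *)

Lemma near_eq_diff (R : realType) (V W : normedModType R) (f g : V -> W)
    (x : V) :
  (\near x, f x = g x) -> differentiable f x -> differentiable g x ->
  'd f x = 'd g x :> (V -> W).
Proof.
move=> fg df dg; apply/funext => u.
by rewrite -!deriveE //; exact: near_eq_derive.
Qed.

(** A local chain rule: [coord] and [param] are inverse to each other only on a chart, so chart
    expressions are composites only near a point. *)
Lemma near_diff_comp (R : realType) (U V W : normedModType R) (f1 : U -> V)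
    (f2 : V -> W) (f : U -> W) (x : U) (y : V) (u : U) :
  f1 x = y -> differentiable f1 x -> differentiable f2 y ->
  (\near x, f x = f2 (f1 x)) -> differentiable f x ->
  'd f x u = 'd f2 y ('d f1 x u).
Proof.
move=> <- df1 df2 fE df.
have -> : 'd f x = 'd (f2 \o f1) x :> (U -> W).
  by apply: near_eq_diff => //; exact: differentiable_comp.
by rewrite diff_comp.
Qed.

Lemma near_diff_id (R : realType) (V : normedModType R) (f : V -> V) (x : V) :
  (\near x, f x = x) -> differentiable f x -> 'd f x = id :> (V -> V).
Proof.
move=> fE df; rewrite (@near_eq_diff _ _ _ f id) //.
by apply/funext => u; rewrite diff_val.
Qed.

Lemma rV_delta_sum (R : pzSemiRingType) n (X : 'rV[R]_n) :
  X = \sum_i X 0 i *: delta_mx 0 i.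
Proof.
apply/rowP => j; rewrite summxE (bigD1 j) //= big1 ?addr0 => [|i /negPf ij].
  by rewrite !mxE !eqxx mulr1.
by rewrite !mxE eqxx eq_sym ij mulr0.
Qed.

(** * Inner products on row vectors, through the Gram matrix *)

Section DotProduct.
Variables (R : realType) (n : nat) (I : {dot 'rV[R]_n for idfun}).

Definition gram : 'M[R]_n := \matrix_(i, j) I (delta_mx 0 i) (delta_mx 0 j).

Lemma dotE u w : I u w = \sum_i \sum_j u 0 i * w 0 j * gram i j.
Proof.
rewrite {1}(rV_delta_sum u) linear_sumlz /=; apply: eq_bigr => i _.
rewrite {1}(rV_delta_sum w) linear_sumr /=; apply: eq_bigr => j _.
by rewrite linearZl_LR linearZr_LR /= mxE mulrA.
Qed.

Lemma dot_gram u j : I u (delta_mx 0 j) = (u *m gram) 0 j.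
Proof.
rewrite {1}(rV_delta_sum u) linear_sumlz /= mxE; apply: eq_bigr => i _.
by rewrite linearZl_LR /= mxE.
Qed.

Lemma dot_ge0 u : 0 <= I u u.
Proof.
have [->|u0] := eqVneq u 0; first by rewrite linear0r.
by rewrite ltW// neq0_dnorm_gt0.
Qed.

Lemma dot_eq0 u : (I u u == 0) = (u == 0).
Proof.
apply/idP/idP => [|/eqP ->]; last by rewrite linear0r.
by apply: contraLR => u0; rewrite gt_eqF// neq0_dnorm_gt0.
Qed.

(** A vector of the kernel is orthogonal to the basis, hence to itself, and definiteness makes it
    0. *)
Lemma gram_unit : gram \in unitmx.
Proof.
rewrite -row_free_unit -kermx_eq0; apply/eqP/row_matrixP => i; rewrite row0.
set u := row i _.
have u0 : u *m gram = 0 by rewrite -row_mul mulmx_ker row0.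
apply/eqP; rewrite -dot_eq0 {2}(rV_delta_sum u) linear_sumr big1 //= => j _.
by rewrite linearZr_LR /= dot_gram u0 [X in _ * X]mxE mulr0.
Qed.

Lemma dot_riesz (f : {linear 'rV[R]_n -> R^o}) : exists Y, forall X, f X = I Y X.
Proof.
exists ((\row_j f (delta_mx 0 j)) *m invmx gram) => X.
rewrite (rV_delta_sum X) linear_sum linear_sumr; apply: eq_bigr => j _.
rewrite linearZ linearZr_LR /= dot_gram mulmxKV ?gram_unit // mxE.
by [].
Qed.

(** Transfers continuity from the products with the basis vectors to the coordinates. *)
Lemma dot_coord (u : 'rV[R]_n) i :
  u 0 i = \sum_j I u (delta_mx 0 j) * invmx gram j i.
Proof.
rewrite -[in LHS](mulmxK gram_unit u) mxE; apply: eq_bigr => j _.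
by rewrite dot_gram.
Qed.

End DotProduct.

Lemma cvg_sum_ord (R : realType) n (T : Type) (F : set_system T)
    {FF : Filter F} (f : 'I_n -> T -> R) (a : 'I_n -> R) :
  (forall i, f i @ F --> a i) -> \sum_i f i t @[t --> F] --> \sum_i a i.
Proof.
move=> fa.
by apply: (@cvg_big R 'I_n +%R 0 xpredT (@add_continuous R)).
Qed.

(** * Charts, multiplication and left translations *)

Section LieGroupCalculusLemmas.
Variables (R : realType) (n : nat) (G : lieGroupType R n).
Implicit Types (g h p q k x y : G) (X : 'rV[R]_n).

Local Notation chart_at := (@chart_at R n G).

Lemma paramK p x : dom (chart_at p) x ->
  param (chart_at p) (coord (chart_at p) x) = x.
Proof. by move=> px; have [_ _ + _ _] := chart_atP p; apply. Qed.

Lemma coordK p z : chart_codom (chart_at p) z ->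
  coord (chart_at p) (param (chart_at p) z) = z.
Proof. by move=> [x px <-]; rewrite paramK. Qed.

Lemma param_dom p z : chart_codom (chart_at p) z ->
  dom (chart_at p) (param (chart_at p) z).
Proof. by move=> [x px <-]; rewrite paramK. Qed.

Lemma codom_coord p x : dom (chart_at p) x ->
  chart_codom (chart_at p) (coord (chart_at p) x).
Proof. by exists x. Qed.

Lemma near_dom p x : dom (chart_at p) x -> \forall y \near x, dom (chart_at p) y.
Proof.
by move=> px; have [op _ _ _ _] := chart_atP p; exact: open_nbhs_nbhs.
Qed.

Lemma near_codom p x : dom (chart_at p) x ->
  \forall z \near coord (chart_at p) x, chart_codom (chart_at p) z.
Proof.
move=> px; have [_ op _ _ _] := chart_atP p.
by apply: open_nbhs_nbhs; split => //; exact: codom_coord.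
Qed.

Lemma chart_coord_continuous p x : dom (chart_at p) x ->
  {for x, continuous (coord (chart_at p))}.
Proof. by move=> px; have [_ _ _ + _] := chart_atP p; apply. Qed.

Lemma chart_param_continuous p x : dom (chart_at p) x ->
  param (chart_at p) z @[z --> coord (chart_at p) x] --> x.
Proof.
move=> px; have [_ _ _ _ c] := chart_atP p.
have := c _ (codom_coord px); rewrite /prop_for /continuous_at.
by rewrite (paramK px).
Qed.

Lemma near_param p x (U : set G) : dom (chart_at p) x -> nbhs x U ->
  \forall z \near coord (chart_at p) x, U (param (chart_at p) z).
Proof. by move=> px Ux; exact: (chart_param_continuous px Ux). Qed.

Lemma mul_continuous2 (T : topologicalType) (F : set_system T) {FF : Filter F}
    (f1 f2 : T -> G) x y :
  f1 @ F --> x -> f2 @ F --> y -> (f1 t * f2 t)%g @[t --> F] --> (x * y)%g.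
Proof.
move=> f1x f2y; have := @lie_mul_continuous R n G (x, y).
apply: (@cvg_comp _ _ _ (fun t => (f1 t, f2 t)) (fun z : G * G => z.1 * z.2)%g).
exact: cvg_pair.
Qed.

Definition mul_coord p q k (z : 'rV[R]_n * 'rV[R]_n) : 'rV[R]_n :=
  coord (chart_at k) (param (chart_at p) z.1 * param (chart_at q) z.2)%g.

Section MulCoord.
Variables (p q k x y : G).
Hypotheses (px : dom (chart_at p) x) (qy : dom (chart_at q) y).
Hypothesis kxy : dom (chart_at k) (x * y)%g.

Let mem : [/\ chart_codom (chart_at p) (coord (chart_at p) x),
  chart_codom (chart_at q) (coord (chart_at q) y) &
  dom (chart_at k) (param (chart_at p) (coord (chart_at p) x) *
                    param (chart_at q) (coord (chart_at q) y))%g].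
Proof. by split; [exact: codom_coord|exact: codom_coord|rewrite !paramK]. Qed.

Lemma mul_coord_differentiable :
  differentiable (mul_coord p q k) (coord (chart_at p) x, coord (chart_at q) y).
Proof.
have [_ /(_ 1%N) /= [_ [d _]]] := @lie_mul_smooth R n G p q k.
(* The remaining membership condition is [mem], found in the context. *)
by apply: d => /=.
Qed.

Lemma diff_mul_coord_continuous u :
  {for (coord (chart_at p) x, coord (chart_at q) y),
    continuous (fun z => 'd (mul_coord p q k) z u)}.
Proof.
have [_ /(_ 1%N) /= [_ [_ d]]] := @lie_mul_smooth R n G p q k.
by have [+ _] := d u; apply => /=.
Qed.

End MulCoord.

(** Left translation is the multiplication with its first factor frozen at the coordinates of [a] in
    its preferred chart. *)
Lemma left_mul_differentiable (a g q k : G) :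
  dom (chart_at q) g -> dom (chart_at k) (a * g)%g ->
  differentiable (fun z => coord (chart_at k) (a * param (chart_at q) z)%g)
    (coord (chart_at q) g).
Proof.
move=> qg kag.
have -> : (fun z => coord (chart_at k) (a * param (chart_at q) z)%g) =
    mul_coord a q k \o (fun z => (coord (chart_at a) a, z)).
  by apply/funext => z; rewrite /mul_coord /= paramK //; exact: mem_chart_at.
apply: differentiable_comp; first exact: differentiable_pair.
by apply: mul_coord_differentiable => //; exact: mem_chart_at.
Qed.

(** The chain rule for a composite of left translations. Associativity is rewritten first so that
    both sides use the same preferred chart at the image point. *)
Lemma TL_mul (a b g : G) X : TL (a * b)%g g X = TL a (b * g)%g (TL b g X).
Proof.
rewrite /TL /tangent_map /= -mulgA.
set F := _ \o _ \o param (chart_at g).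
set F1 := _ \o _ \o param (chart_at g).
set F2 := _ \o _ \o param (chart_at (b * g)%g).
set z := coord (chart_at g) g.
have F1z : F1 z = coord (chart_at (b * g)%g) (b * g)%g.
  by rewrite /F1 /z /= paramK//; exact: mem_chart_at.
have dF1 : differentiable F1 z.
  by apply: left_mul_differentiable; exact: mem_chart_at.
have dF2 : differentiable F2 (F1 z).
  by rewrite F1z; apply: left_mul_differentiable; exact: mem_chart_at.
rewrite F1z in dF2; apply: (near_diff_comp _ F1z dF1 dF2).
- have bz : (b * param (chart_at g) y)%g @[y --> z] --> (b * g)%g.
    exact: (mul_continuous2 (cvg_cst b) (chart_param_continuous (mem_chart_at g))).
  have : \forall y \near z,
      dom (chart_at (b * g)%g) (b * param (chart_at g) y)%g.
    exact: bz _ (near_dom (mem_chart_at (b * g)%g)).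
  apply: filterS => y by_; rewrite /F /F1 /F2 /= paramK//.
  by rewrite -mulgA.
- by apply: left_mul_differentiable; [|rewrite -mulgA]; exact: mem_chart_at.
Qed.

Lemma TL1 g X : TL 1%g g X = X.
Proof.
rewrite /TL /tangent_map mul1g.
set F := _ \o _; suff -> : 'd F (coord (chart_at g) g) = id :> (_ -> _) by [].
apply: near_diff_id.
- have := near_codom (mem_chart_at g); apply: filterS => z gz.
  by rewrite /F /= mul1g coordK.
- by apply: left_mul_differentiable; rewrite ?mul1g; exact: mem_chart_at.
Qed.

(** Together with [TLVK], this identifies the Lie algebra with each tangent space. *)
Lemma TLK g X : TL g^-1%g g (TL g 1%g X) = X.
Proof. by have := TL_mul g^-1%g g 1%g X; rewrite mulVg mulg1 TL1 => <-. Qed.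

Lemma TLVK g X : TL g 1%g (TL g^-1%g g X) = X.
Proof. by have := TL_mul g g^-1%g g X; rewrite mulVg mulgV TL1 => <-. Qed.

End LieGroupCalculusLemmas.

(** * Derivatives along curves in normed spaces *)

Lemma is_derive_translate (R : realType) (W : normedModType R) (f : R -> W)
    (s : R) (u : W) :
  is_derive (0 : R) 1 (fun t => f (s + t)) u -> is_derive s 1 f u.
Proof.
move=> [df du].
have E : (fun h => h^-1 *: (((fun t => f (s + t)) \o shift 0) (h *: (1 : R^o)) -
      f (s + 0))) = (fun h : R => h^-1 *: ((f \o shift s) (h *: (1 : R^o)) - f s)).
  by apply/funext => h /=; rewrite !addr0 [s + _]addrC.
by split; move: df du; rewrite /derivable /derive E.
Qed.

Lemma is_derive_diff_comp (R : realType) (V W : normedModType R) (f1 : R -> V)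
    (f2 : V -> W) (f : R -> W) (s : R) (y u : V) :
  f1 s = y -> is_derive s 1 f1 u -> differentiable f2 y ->
  (\near s, f s = f2 (f1 s)) -> is_derive s 1 f ('d f2 y u).
Proof.
move=> <- [df1 <-] df2 fE; apply: (@near_eq_is_derive _ _ _ (f2 \o f1)).
  by near=> t; apply/esym; near: t.
have {}df1 : differentiable f1 s by exact/derivable1_diffP.
have df : differentiable (f2 \o f1) s by exact: differentiable_comp.
by split; [exact/derivable1_diffP|rewrite !deriveE// diff_comp].
Unshelve. all: by end_near. Qed.

Lemma diff_pair_cst (R : realType) (V W : normedModType R) (a : V) (x : W) :
  'd (fun z : W => (a, z)) x = (fun u => (0, u)) :> (W -> V * W).
Proof.
by rewrite (@diff_val _ _ _ _ _ _ _ (is_diff_pair (is_diff_cst a x) (is_diff_id x))).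
Qed.

Lemma is_derive_pair_cst (R : realType) (V W : normedModType R) (a : V)
    (f : R -> W) (s : R) (u : W) :
  is_derive s 1 f u -> is_derive s 1 (fun t => (a, f t)) (0, u).
Proof.
move=> [df <-]; have {}df : differentiable f s by exact/derivable1_diffP.
have dp : differentiable (fun t => (a, f t)) s by exact: differentiable_pair.
split; first exact/derivable1_diffP.
by rewrite !deriveE// diff_pair//= diff_val.
Qed.

(** * Left invariant fields and derivatives along exponential curves *)

Section LieExponential.
Variables (R : realType) (n : nat) (G : lieGroupType R n).
Variables (exp : 'rV[R]_n -> G) (hexp : is_lie_exp exp).
Implicit Types (g h k : G) (X : 'rV[R]_n) (s t : R).

Local Notation chart_at := (@chart_at R n G).

Lemma exp_add X s t : exp ((s + t) *: X) = (exp (s *: X) * exp (t *: X))%g.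
Proof. by have [[_ ->]] := hexp X. Qed.

Lemma exp0 X : exp (0 *: X) = 1%g.
Proof.
have := exp_add X 0 0; rewrite addr0 => /(congr1 (fun g => (exp (0 *: X))^-1 * g)%g).
by rewrite mulKg mulVg => <-.
Qed.

Lemma lie_exp_continuous X : continuous (fun t => exp (t *: X)).
Proof. by have [[[]]] := hexp X. Qed.

Lemma exp_is_derive0 X :
  is_derive (0 : R) 1 (fun t => coord (chart_at 1%g) (exp (t *: X))) X.
Proof.
have [[[_ /(_ 1%g) [_ /(_ 1%N) /= [_ [d _]]]] _]] := hexp X.
rewrite /velocity exp0 derive1E => dX; split => //.
by apply/derivable1_diffP/d; rewrite /preimage /= exp0; exact: mem_chart_at.
Qed.

(* The coordinates, in the chart at [k], of the value at [h] of the left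
   invariant vector field defined by [X]. *)
Definition invariant_field k h X : 'rV[R]_n :=
  'd (mul_coord k (1%g : G) k)
     (coord (chart_at k) h, coord (chart_at 1%g) 1%g) (0, X).

(** With [h = g * exp (s *: X)], the curve at time [s + t] is [h * exp (t *: X)]. This reduces the
    derivative to time 0, where the velocity of the exponential is [X]. *)
Lemma mul_exp_is_derive k g X s : dom (chart_at k) (g * exp (s *: X))%g ->
  is_derive s 1 (fun t => coord (chart_at k) (g * exp (t *: X))%g)
    (invariant_field k (g * exp (s *: X))%g X).
Proof.
set h := (g * _)%g => kh; apply: is_derive_translate.
apply: (is_derive_diff_comp _ (is_derive_pair_cst _ (exp_is_derive0 X))).
- by rewrite exp0.
- by apply: mul_coord_differentiable => //; [exact: mem_chart_at|rewrite mulg1].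
- have := @lie_exp_continuous X 0; rewrite /continuous_at exp0.
  move=> /(_ _ (near_dom (mem_chart_at 1%g))) c1.
  near=> t; rewrite /mul_coord /= !paramK//; last by near: t; exact: c1.
  by rewrite /h -mulgA -exp_add.
Unshelve. all: by end_near. Qed.

Lemma invariant_field_TL h X : invariant_field h h X = TL h 1%g X.
Proof.
rewrite /TL /tangent_map mulg1 /invariant_field.
set y := coord (chart_at 1%g) 1%g; set x := coord (chart_at h) h.
have h1 : differentiable (mul_coord h (1%g : G) h) (x, y).
  apply: mul_coord_differentiable; [| |rewrite mulg1]; exact: mem_chart_at.
have dp : differentiable (fun z : 'rV[R]_n => (x, z)) y.
  exact: differentiable_pair.
have -> : (0, X) = 'd (fun z : 'rV[R]_n => (x, z)) y X.
  by rewrite diff_pair_cst.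
apply/esym; apply: near_diff_comp => //.
- by near=> z; rewrite /mul_coord /= paramK//; exact: mem_chart_at.
- by apply: left_mul_differentiable; rewrite ?mulg1; exact: mem_chart_at.
Unshelve. all: by end_near. Qed.

(** The chart [k] stays fixed while the point moves, whereas [TL] uses the preferred chart at the
    moving point, which need not vary continuously. *)
Lemma invariant_field_continuous k h X : dom (chart_at k) h ->
  {for h, continuous (fun x => invariant_field k x X)}.
Proof.
move=> kh; rewrite /invariant_field.
apply: (@continuous_comp _ _ _ (fun x => (coord (chart_at k) x,
  coord (chart_at 1%g) 1%g)) (fun z => 'd (mul_coord k (1%g : G) k) z (0, X))).
  exact: (cvg_pair (chart_coord_continuous kh) (cvg_cst _)).
by apply: diff_mul_coord_continuous => //; [exact: mem_chart_at|rewrite mulg1].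
Qed.

Variables (v : G -> R) (hv : C1 v).

Definition lie_derivative X h : R := differential v h (TL h 1%g X).

Lemma v_param_differentiable k h : dom (chart_at k) h ->
  differentiable (v \o param (chart_at k)) (coord (chart_at k) h).
Proof. by move=> kh; have /= [_ [d _]] := hv k; apply: d; exact: codom_coord. Qed.

Lemma v_continuous : continuous v.
Proof.
move=> h; have /= [c _] := hv h.
have ch := c _ (codom_coord (mem_chart_at h)).
have E : \forall x \near h, v (param (chart_at h) (coord (chart_at h) x)) = v x.
  by have := near_dom (mem_chart_at h); apply: filterS => x hx; rewrite paramK.
rewrite /continuous_at -(nbhs_singleton E).
apply: cvg_trans; first exact: near_eq_cvg E.
exact: continuous_comp (chart_coord_continuous (mem_chart_at h)) ch.
Qed.

Lemma v_mul_exp_is_derive_chart k g X s : dom (chart_at k) (g * exp (s *: X))%g ->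
  is_derive s 1 (fun t => v (g * exp (t *: X))%g)
    ('d (v \o param (chart_at k)) (coord (chart_at k) (g * exp (s *: X))%g)
       (invariant_field k (g * exp (s *: X))%g X)).
Proof.
move=> kh; apply: (is_derive_diff_comp _ (mul_exp_is_derive kh)) => //.
  exact: v_param_differentiable.
have c : (g * exp (t *: X))%g @[t --> s] --> (g * exp (s *: X))%g.
  by apply: (mul_continuous2 (cvg_cst g)); exact: lie_exp_continuous.
near=> t; rewrite /= paramK//; near: t; exact: c _ (near_dom kh).
Unshelve. all: by end_near. Qed.

Lemma v_mul_exp_is_derive g X s :
  is_derive s 1 (fun t => v (g * exp (t *: X))%g)
    (lie_derivative X (g * exp (s *: X))%g).
Proof.
rewrite /lie_derivative -invariant_field_TL.
exact: v_mul_exp_is_derive_chart (mem_chart_at _).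
Qed.

(** Both sides are the derivative at 0 of the same function [v (h * exp (t *: X))], computed in two
    charts, so no change of coordinates has to be differentiated. *)
Lemma lie_derivative_chart k h X : dom (chart_at k) h ->
  lie_derivative X h = 'd (v \o param (chart_at k)) (coord (chart_at k) h)
    (invariant_field k h X).
Proof.
have E : (h * exp (0 *: X))%g = h by rewrite exp0 mulg1.
rewrite -E => kh.
have [_ <-] := v_mul_exp_is_derive h X 0.
by have [_ <-] := v_mul_exp_is_derive_chart kh.
Qed.

(** The chart is frozen at [h]. Since [C1] gives continuity of the differential in fixed directions,
    the moving direction is expanded in the basis. *)
Lemma lie_derivative_continuous X : continuous (lie_derivative X).
Proof.
move=> h; pose k := h; have kh : dom (chart_at k) h by exact: mem_chart_at.
pose f z i := 'd (v \o param (chart_at k)) z (delta_mx 0 i).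
have E : \forall x \near h, \sum_i invariant_field k x X 0 i *
    f (coord (chart_at k) x) i = lie_derivative X x.
  have := near_dom kh; apply: filterS => x kx.
  rewrite (lie_derivative_chart _ kx) [in RHS](rV_delta_sum (invariant_field _ _ _)).
  by rewrite linear_sum; apply: eq_bigr => i _; rewrite linearZ.
rewrite /continuous_at -(nbhs_singleton E).
apply: cvg_trans; first exact: (near_eq_cvg E).
apply: cvg_sum_ord => i; apply: cvgM.
- apply: (@continuous_comp _ _ _ (invariant_field k ^~ X)
    (fun M : 'rV[R]_n => M 0 i)); first exact: invariant_field_continuous.
  exact: coord_continuous.
- apply: (@continuous_comp _ _ _ (coord (chart_at k)) (f ^~ i)).
    exact: chart_coord_continuous.
  have /= [_ [_ /(_ (delta_mx 0 i)) [+ _]]] := hv k.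
  by apply; exact: codom_coord.
Qed.

End LieExponential.

(** * Existence and continuity of the left gradient *)

Section LeftGradient.
Variables (R : realType) (n : nat) (G : lieGroupType R n).
Variables (exp : 'rV[R]_n -> G) (hexp : is_lie_exp exp).
Variable I : {dot 'rV[R]_n for idfun}.
Variables (v : G -> R) (hv : C1 v).
Implicit Types (g h : G) (X : 'rV[R]_n).

Local Notation chart_at := (@chart_at R n G).
Local Notation xi := (left_gradient I v).

Lemma gradientP h X :
  differential v h X = left_invariant_metric I h (gradient I v h) X.
Proof.
(* The functional is [differential v h \o TL h 1], unfolded to expose its linear structure. Its
   representative, carried to the tangent space at [h], shows that [xget] does not fall back on its
   default value. *)
have [Y HY] := dot_riesz I ('d (v \o param (chart_at h)) (coord (chart_at h) h)
  \o 'd (coord (chart_at (h * 1)%g) \o (fun x => h * x)%g \o param (chart_at 1%g))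
        (coord (chart_at 1%g) (1%g : G))).
have : [set Y | forall X, differential v h X = left_invariant_metric I h Y X]
    (TL h 1%g Y).
  move=> Z; rewrite /left_invariant_metric TLK -HY.
  by rewrite -[in LHS](TLVK h Z).
by move=> PY; exact: (xgetPex 0 (ex_intro _ _ PY) X).
Qed.

(** The gradient equation tested on [TL h 1 X]; it links the gradient to derivatives along
    exponential curves. *)
Lemma dot_left_gradient h X : I (xi h) X = lie_derivative v X h.
Proof. by rewrite /lie_derivative gradientP /left_invariant_metric TLK. Qed.

Lemma left_gradient0_gradient0 h : xi h = 0 -> gradient I v h = 0.
Proof.
move=> xi0; rewrite -[LHS](TLVK h) -/(left_gradient I v h) xi0.
by rewrite /TL /tangent_map linear0.
Qed.

Lemma left_gradient_sq_eq0 h : (left_gradient_sq I v h == 0) = (xi h == 0).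
Proof. exact: dot_eq0. Qed.

Lemma gradient_norm_eq0 h : (gradient_norm I v h == 0) = (xi h == 0).
Proof.
rewrite /gradient_norm /left_invariant_metric -/(left_gradient I v h).
rewrite -/(left_gradient_sq I v h).
have ge0 : 0 <= left_gradient_sq I v h by exact: dot_ge0.
by rewrite sqrtr_eq0 -left_gradient_sq_eq0 eq_le ge0 andbT.
Qed.

Lemma left_gradient_coord_continuous i : continuous (fun h => xi h 0 i).
Proof.
have -> : (fun h => xi h 0 i) = fun h =>
    \sum_j lie_derivative v (delta_mx 0 j) h * invmx (gram I) j i.
  apply/funext => h; rewrite (dot_coord I (xi h)); apply: eq_bigr => j _.
  by rewrite dot_left_gradient.
move=> h; apply: cvg_sum_ord => j; apply: cvgMl.
exact: (lie_derivative_continuous hexp hv).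
Qed.

Lemma cvg_dot (T : Type) (F : set_system T) {FF : Filter F}
    (f1 f2 : T -> 'rV[R]_n) (a1 a2 : 'rV[R]_n) :
  (forall i, f1 t 0 i @[t --> F] --> a1 0 i) ->
  (forall i, f2 t 0 i @[t --> F] --> a2 0 i) ->
  I (f1 t) (f2 t) @[t --> F] --> I a1 a2.
Proof.
move=> c1 c2; rewrite (dotE I a1 a2).
have -> : (fun t => I (f1 t) (f2 t)) = fun t =>
    \sum_i \sum_j f1 t 0 i * f2 t 0 j * gram I i j.
  by apply/funext => t; exact: dotE.
apply: cvg_sum_ord => i; apply: cvg_sum_ord => j.
by apply: cvgMl; apply: cvgM.
Qed.

(** Joint convergence in the point and in the displacement from it is what makes the decrease of [v]
    uniform near [h]. *)
Lemma dot_left_gradient_mul_cvg h :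
  I (xi (z.1 * z.2)%g) (xi z.1) @[z --> (h, 1%g : G)] --> I (xi h) (xi h).
Proof.
have c1 : (z.1 * z.2)%g @[z --> (h, 1%g : G)] --> h.
  have := @lie_mul_continuous R n G (h, 1%g).
  by rewrite /continuous_at /= mulg1.
have c2 : z.1 @[z --> (h, 1%g : G)] --> h by exact: cvg_fst.
apply: cvg_dot => i.
  exact: cvg_comp c1 (@left_gradient_coord_continuous i h).
exact: cvg_comp c2 (@left_gradient_coord_continuous i h).
Qed.

End LeftGradient.

(** * Mean value inequality and confinement of curves *)

Lemma rV_norm_le (R : realType) n (A : 'rV[R]_n) (K : R) :
  0 <= K -> (forall i, `|A 0 i| <= K) -> `|A| <= K.
Proof.
move=> K0 AK; rewrite [leLHS]/Num.Def.normr/= mx_normrE.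
by rewrite (bigmax_le _ K0)//= => -[i j] _; rewrite ord1; exact: AK.
Qed.

Lemma rV_coord_le_norm (R : realType) n (A : 'rV[R]_n) i : `|A 0 i| <= `|A|.
Proof.
rewrite [leRHS]/Num.Def.normr/= mx_normrE.
exact: (le_bigmax _ (fun ij => `|A ij.1 ij.2|) (0, i)).
Qed.

(** The mean value theorem in each coordinate; no constant is lost because the norm is the max
    norm. *)
Lemma rV_mean_value (R : realType) n (c c' : R -> 'rV[R]_n) (K s : R) :
  0 <= s -> (forall u, 0 <= u <= s -> is_derive u 1 c (c' u)) ->
  (forall u, 0 <= u <= s -> `|c' u| <= K) -> `|c s - c 0| <= K * s.
Proof.
move=> s0 dc c'K; have K0 : 0 <= K.
  by apply: le_trans (c'K 0 _); rewrite ?normr_ge0// lexx s0.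
apply: rV_norm_le => [|i]; first exact: mulr_ge0.
have dci u : 0 <= u <= s -> is_derive u 1 (fun t => c t 0 i) (c' u 0 i).
  move=> /dc [dcu <-]; split; first by have /derivable_mxP := dcu.
  by rewrite derive_mx// mxE.
move: s0; rewrite le_eqVlt => /predU1P[<-|s0].
  by rewrite subrr mxE normr0 mulr0.
have [u||u us] := @MVT _ (fun t => c t 0 i) (fun u => c' u 0 i) 0 s s0.
- by rewrite in_itv/= => /andP[/ltW u0 /ltW us]; apply: dci; rewrite u0.
- apply: derivable_within_continuous => u; rewrite in_itv/= => us.
  by have [] := dci _ us.
- rewrite !mxE => ->; rewrite subr0 normrM (ger0_norm (ltW s0)) ler_pM2r//.
  move: us; rewrite in_itv/= => /andP[/ltW u0 /ltW us].
  by apply: (le_trans (rV_coord_le_norm _ _)); apply: c'K; rewrite u0.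
Qed.

(** Let [s0] be the infimum of the times outside [V]. Before [s0] the a priori bound puts the curve
    in [F]; closedness of [F] (or [V (c 0)] if [s0 = 0]) gives [V (c s0)]. As [V] is open, the curve
    remains in it slightly beyond [s0], a contradiction. *)
Lemma continuous_stays (R : realType) (T : topologicalType) (c : R -> T)
    (V F : set T) (tau : R) :
  continuous c -> open V -> closed F -> F `<=` V -> V (c 0) ->
  (forall s, 0 <= s <= tau -> (forall u, 0 <= u <= s -> V (c u)) -> F (c s)) ->
  forall s, 0 <= s <= tau -> V (c s).
Proof.
move=> cc oV cF FV V0 stay s sI; apply: contrapT => nVs.
pose E := [set u | 0 <= u <= tau /\ ~ V (c u)].
have Es : E s by [].
have lE : lbound E 0 by move=> u [/andP[]].
have iE : has_inf E by split; [exists s|exists 0].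
set s0 := inf E.
have s00 : 0 <= s0 by apply: lb_le_inf => //; exists s.
have s0s : s0 <= s by apply: ge_inf => //; exists 0.
have before u : 0 <= u < s0 -> V (c u).
  move=> /andP[u0 us]; apply: contrapT => nVu.
  have : s0 <= u; last by rewrite leNgt us.
  apply: ge_inf; first by exists 0.
  split => //; rewrite u0 (le_trans (ltW us))// (le_trans s0s)//.
  by case/andP: sI.
have Vs0 : V (c s0).
  move: s00; rewrite le_eqVlt => /predU1P[<-//|s00].
  apply: FV; apply: (@closed_cvg _ _ s0^'- _ c F cF); last first.
    by apply: cvg_at_left_filter; exact: cc.
  near=> u; have u0 : 0 <= u by near: u; exact: nbhs_left_ge.
  have us : u < s0 by near: u; exact: nbhs_left_lt.
  apply: stay => [|w /andP[w0 wu]].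
    by rewrite u0 (le_trans (ltW us))// (le_trans s0s)//; case/andP: sI.
  by apply: before; rewrite w0 (le_lt_trans wu).
have /nbhs_ballP[e /= e0 eV] : \forall u \near s0, V (c u).
  by apply: cc; exact: open_nbhs_nbhs.
have [u [uI nVu] us0] := inf_adherent e0 iE.
have s0u : s0 <= u by apply: ge_inf => //; exists 0.
by apply: nVu; apply: eV; rewrite /ball/= distrC ger0_norm ?ltrBlDl// subr_ge0.
Unshelve. all: by end_near. Qed.

(** * Uniform smallness of the exponential for small times *)

Section SmallTimes.
Variables (R : realType) (n : nat) (G : lieGroupType R n).
Variables (exp : 'rV[R]_n -> G) (hexp : is_lie_exp exp).
Implicit Types (g h k : G) (X : 'rV[R]_n) (s t : R).

Local Notation chart_at := (@chart_at R n G).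

Lemma invariant_field_sum k h X : invariant_field k h X =
  \sum_i X 0 i *: invariant_field k h (delta_mx 0 i).
Proof.
(* The injection of the second factor is written as a differential to make its linearity
   available. *)
have E u : (0, u) = 'd (fun z : 'rV[R]_n => (0 : 'rV[R]_n, z)) 0 u.
  by rewrite diff_pair_cst.
rewrite /invariant_field E {1}(rV_delta_sum X) !linear_sum.
by apply: eq_bigr => i _; rewrite E !linearZ.
Qed.

Lemma param_image_open p (A : set 'rV[R]_n) :
  open A -> A `<=` chart_codom (chart_at p) -> open (param (chart_at p) @` A).
Proof.
move=> oA Ap; rewrite openE => _ [z Az <-].
have pz : dom (chart_at p) (param (chart_at p) z) by apply/param_dom/Ap.
have := chart_coord_continuous pz; rewrite /prop_for /continuous_at (coordK (Ap _ Az)).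
move=> /(_ A (open_nbhs_nbhs (conj oA Az))) Ac; near=> x.
exists (coord (chart_at p) x); first by near: x.
by apply: paramK; near: x; exact: near_dom.
Unshelve. all: by end_near. Qed.

Lemma param_image_compact p (A : set 'rV[R]_n) :
  compact A -> A `<=` chart_codom (chart_at p) ->
  compact (param (chart_at p) @` A).
Proof.
move=> cA Ap; apply: continuous_compact => //.
apply: continuous_in_subspaceT => z; rewrite inE => /Ap.
by have [_ _ _ _] := chart_atP p; apply.
Qed.

(** [is_lie_exp] constrains each ray separately; uniformity in [X] comes from a speed bound. While
    the curve stays in [U'], its speed in the chart at 1 is at most [M * C], so up to the chosen
    time it moves by at most [r / 2]; [continuous_stays] removes the proviso. *)
Lemma exp_small (U : set G) (M : R) : nbhs 1%g U -> 0 <= M ->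
  exists2 tau, 0 < tau & forall X s, (forall i, `|X 0 i| <= M) ->
    0 <= s <= tau -> U (exp (s *: X)).
Proof.
move=> U1 M0; set p : G := 1%g; set y0 := coord (chart_at p) p.
have pp : dom (chart_at p) p by exact: mem_chart_at.
pose C := \sum_i (`|invariant_field p p (delta_mx 0 i)| + 1).
have C0 : 0 <= C by apply: sumr_ge0 => i _; exact: addr_ge0.
pose U' := [set x | [/\ dom (chart_at p) x, U x & forall i,
  `|invariant_field p x (delta_mx 0 i)| <=
  `|invariant_field p p (delta_mx 0 i)| + 1]].
have U'p : nbhs p U'.
  near=> x; split; [by near: x; exact: near_dom|by near: x|].
  near: x; apply: filter_forall => i.
  have /cvg_norm c := @invariant_field_continuous _ _ _ p p (delta_mx 0 i) pp.
  by apply: (cvgr_le _ c); rewrite ltrDl.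
have bound x X : U' x -> (forall i, `|X 0 i| <= M) ->
    `|invariant_field p x X| <= M * C.
  move=> [_ _ xi] XM; rewrite invariant_field_sum mulr_sumr.
  apply: (le_trans (ler_norm_sum _ _ _)); apply: ler_sum => i _.
  by rewrite normrZ ler_pM.
have /nbhs_closedballP[r rU] : nbhs y0 (chart_codom (chart_at p) `&`
    [set z | U' (param (chart_at p) z)]).
  apply: filterI; first exact: near_codom.
  exact: near_param.
pose F := param (chart_at p) @` closed_ball y0 (r%:num / 2).
pose V := param (chart_at p) @` ball y0 r%:num.
have rr : closed_ball y0 (r%:num / 2) `<=` ball y0 r%:num.
  by apply: closed_ball_subset; rewrite ?divr_gt0 ?ltr_pdivrMr ?ltr_pMr ?ltr1n.
have brU : ball y0 r%:num `<=` chart_codom (chart_at p) `&`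
    [set z | U' (param (chart_at p) z)].
  by apply: subset_trans rU; exact: subset_closed_ball.
have VU x : V x -> U' x by move=> [z /brU [_ +] <-].
(* The [+ 1] keeps the denominator positive when [M * C] is 0. *)
exists (r%:num / 2 / (M * C + 1)) => [|X s XM sI].
  by rewrite divr_gt0// ltr_wpDl// mulr_ge0.
suff : V (exp (s *: X)) by move=> /VU [].
apply: (@continuous_stays _ _ (fun t => exp (t *: X)) V F _ _ _ _ _ _ _ s sI).
- exact: lie_exp_continuous.
- by apply: param_image_open; [exact: ball_open|move=> z /brU []].
(* [F] is closed in [G] as the continuous image of a compact ball in a Hausdorff space. *)
- apply: compact_closed; first exact: lie_hausdorff.
  apply: param_image_compact; last by move=> z /rr /brU [].
  apply: bounded_closed_compact; last exact: closed_ball_closed.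
  exists (`|y0| + r%:num / 2); split => [|B yB z /=]; first exact: num_real.
  rewrite closed_ballE// /closed_ball_/= distrC => zr.
  rewrite -(subrK y0 z) addrC; apply: (le_trans (ler_normD _ _)).
  by apply: le_trans (ltW yB); rewrite lerD2l.
- by move=> x [z /rr zr <-]; exists z.
- by rewrite exp0//; exists y0; [exact: ballxx|exact: paramK].
- move=> {}s {}sI Vs; exists (coord (chart_at p) (exp (s *: X))); last first.
    by apply: paramK; have [|//] := VU _ (Vs s _); case/andP: sI => -> _ /=.
  rewrite closed_ballE// /closed_ball_/= distrC.
  rewrite -[y0](_ : coord (chart_at p) (exp (0 *: X)) = _); last by rewrite exp0.
  apply: (le_trans (@rV_mean_value _ _ (fun t => coord (chart_at p) (exp (t *: X)))
    (fun u => invariant_field p (exp (u *: X)) X) (M * C) s _ _ _)).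
  + by case/andP: sI.
  + move=> u us; have [pu _ _] := VU _ (Vs u us).
    have := @mul_exp_is_derive _ _ _ _ hexp p 1%g X u.
    rewrite mul1g => /(_ pu); under eq_fun do rewrite mul1g.
    by [].
  + by move=> u us; apply: bound => //; exact: VU (Vs u us).
  + case/andP: sI => s0; rewrite ler_pdivlMr ?ltr_wpDl ?mulr_ge0// => sr.
    by apply: (le_trans _ sr); rewrite mulrC ler_wpM2l// lerDl.
Unshelve. all: by end_near. Qed.

End SmallTimes.

(** * Real functions up to a switching time *)

Section NonincreasingUntil.
Variables (R : realType) (f f' : R -> R) (t0 : R).
Hypothesis df : forall t : R, is_derive t 1 f (f' t).

(** For [f := v \o eg_curve I exp v g t0], the supremum of this set is [eg_next_time]. *)
Let S := [set s | t0 <= s < t0 + 1 /\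
  forall t, t0 <= t < s -> derive1 f t <= 0].

Let S0 : S t0.
Proof.
split; first by rewrite lexx ltrDl ltr01.
by move=> t /andP[t0t]; rewrite ltNge t0t.
Qed.

Let ubS : ubound S (t0 + 1).
Proof. by move=> s [/andP[_ /ltW]]. Qed.

Lemma sup_ge_start : t0 <= sup S.
Proof. by apply: ub_le_sup S0; exists (t0 + 1). Qed.

Lemma sup_ge_of_derive_le0 (tau : R) : 0 <= tau < 1 ->
  (forall t, t0 <= t <= t0 + tau -> f' t <= 0) -> t0 + tau <= sup S.
Proof.
move=> /andP[tau0 tau1] f'0; apply: ub_le_sup; first by exists (t0 + 1).
split; first by rewrite lerDl tau0 ltrD2l.
move=> t /andP[t0t tt]; rewrite derive1E.
by have [_ ->] := df t; apply: f'0; rewrite t0t ltW.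
Qed.

Lemma derive_continuous_within (A : set R) : {within A, continuous f}.
Proof.
apply: continuous_subspaceT => t; apply/differentiable_continuous.
by apply/derivable1_diffP; have [] := df t.
Qed.

(** The supremum need not belong to [S], as when it is [t0 + 1]. But every earlier time lies below
    an element of [S], so the derivative is nonpositive inside the interval, and continuity covers
    the endpoint. *)
Lemma nonincreasing_until_sup (t : R) : t0 <= t <= sup S -> f (sup S) <= f t.
Proof.
move=> tS; have S_ge := sup_ge_start.
have d u : u \in `]t0, (sup S)[%R -> derivable f u 1 by have [] := df u.
apply: (ler0_derive1_le_cc d _ (@derive_continuous_within _)).
- move=> u; rewrite in_itv/= => /andP[t0u uS].
  have [s [sI Ss] us] := sup_gt (ex_intro _ _ S0) uS.
  by apply: Ss; rewrite (ltW t0u).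
- by rewrite in_itv/= S_ge lexx.
- by rewrite in_itv/=.
- by case/andP: tS.
Qed.

(** The supremum is at least [t0 + tau]: the mean value theorem gives the drop up to that time, and
    [f] does not rise between it and the supremum. *)
Lemma decrease_until_sup (tau delta : R) : 0 < tau < 1 -> 0 <= delta ->
  (forall t, t0 <= t <= t0 + tau -> f' t <= - delta) ->
  f (sup S) <= f t0 - delta * tau.
Proof.
move=> /andP[tau0 tau1] delta0 f'd.
have tauS : t0 + tau <= sup S.
  apply: sup_ge_of_derive_le0; first by rewrite ltW.
  by move=> t /f'd /le_trans; apply; rewrite oppr_le0.
apply: (@le_trans _ _ (f (t0 + tau))).
  by apply: nonincreasing_until_sup; rewrite lerDl ltW.
have [||t tI E] := @MVT _ f f' t0 (t0 + tau) _ (fun t _ => df t).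
- by rewrite ltrDl.
- exact: derive_continuous_within.
- move: E; rewrite [t0 + tau - t0]addrC addKr => /(canRL (subrK _)) ->.
  rewrite addrC lerD2l -mulNr ler_pM2r//; apply: f'd.
  by move: tI; rewrite in_itv/= => /andP[/ltW -> /ltW ->].
Qed.

End NonincreasingUntil.

(** * Decrease of [v] over one step of the flow *)

Section ExpGradientStep.
Variables (R : realType) (n : nat) (G : lieGroupType R n).
Variables (exp : 'rV[R]_n -> G) (hexp : is_lie_exp exp).
Variable I : {dot 'rV[R]_n for idfun}.
Variables (v : G -> R) (hv : C1 v).
Implicit Types (g h : G) (X : 'rV[R]_n).

Local Notation xi := (left_gradient I v).
Local Notation curve := (eg_curve I exp v).

Lemma eg_curve_start g t0 : curve g t0 t0 = g.
Proof. by rewrite /eg_curve subrr oppr0 (exp0 hexp) mulg1. Qed.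

(** From time [t] on, the curve is its current point times an exponential in the direction [- xi g],
    which stays frozen along the step; only the first argument of [I] follows the curve. *)
Lemma eg_curve_is_derive g (t0 t : R) :
  is_derive t 1 (v \o curve g t0) (- I (xi (curve g t0 t)) (xi g)).
Proof.
have -> : - I (xi (curve g t0 t)) (xi g) =
    lie_derivative v (- xi g) (curve g t0 t).
  by rewrite -(dot_left_gradient I) linearNr.
apply: is_derive_translate.
have -> : (fun u => (v \o curve g t0) (t + u)) =
    (fun u => v (curve g t0 t * exp (u *: - xi g))%g).
  apply/funext => u /=; rewrite /eg_curve -mulgA.
  have E s : - s *: xi g = s *: - xi g by rewrite scaleNr scalerN.
  by rewrite !E -(exp_add hexp) addrAC.
have := v_mul_exp_is_derive hexp hv (curve g t0 t) (- xi g) 0.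
by rewrite (exp0 hexp) mulg1.
Qed.

Lemma eg_step_le g t0 : v (eg_step I exp v (g, t0)).1 <= v g.
Proof.
rewrite /eg_step /=; case: ifP => //= _.
have := @nonincreasing_until_sup _ _ _ t0 (eg_curve_is_derive g t0) t0.
rewrite lexx (sup_ge_start (v \o curve g t0) t0) => /(_ isT) /=.
by rewrite eg_curve_start.
Qed.

(* The continuity of the left gradient and the uniform smallness of [exp] for
   small times make the initial decrease uniform near a non-critical point. *)
Lemma left_gradient_decay h : xi h != 0 ->
  exists tau delta : R, [/\ 0 < tau < 1, 0 < delta &
    \forall g \near h, xi g != 0 /\ forall s, 0 <= s <= tau ->
      delta <= I (xi (g * exp (- s *: xi g))%g) (xi g)].
Proof.
move=> xih; pose delta := I (xi h) (xi h) / 2.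
have Ih0 : 0 < I (xi h) (xi h) by exact: neq0_dnorm_gt0.
have delta0 : 0 < delta by rewrite divr_gt0.
have c := @dot_left_gradient_mul_cvg _ _ _ _ hexp I v hv h.
have deltaI : delta < I (xi h) (xi h).
  by rewrite /delta ltr_pdivrMr// ltr_pMr// ltr1n.
have := cvgr_ge _ c _ deltaI.
(* [A] is a neighbourhood of [h] for the starting point, [B] one of 1 for the displacement. *)
move=> [[A B] /= [Ah B1] AB].
pose M := \sum_i (`|xi h 0 i| + 1).
have M0 : 0 <= M by apply: sumr_ge0 => i _; exact: addr_ge0.
have [tau tau0 tauB] := exp_small hexp B1 M0.
(* The minimum with 1/2 keeps the duration below 1, as [decrease_until_sup] requires. *)
exists (Num.min tau (1 / 2)), delta; split => //.
  by rewrite lt_min tau0 divr_gt0//= gt_min ltr_pdivrMr// mul1r ltr1n orbT.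
have xiM : \forall g \near h, forall i, `|(- xi g) 0 i| <= M.
  apply: filter_forall => i.
  have /cvg_norm ci := @left_gradient_coord_continuous _ _ _ _ hexp I v hv i h.
  have : \forall g \near h, `|xi g 0 i| <= `|xi h 0 i| + 1.
    by apply: (cvgr_le _ ci); rewrite ltrDl.
  apply: filterS => g gi; rewrite mxE normrN (le_trans gi)// /M.
  by rewrite (bigD1 i)//= lerDl; apply: sumr_ge0 => j _; exact: addr_ge0.
near=> g.
have decay s : 0 <= s <= Num.min tau (1 / 2) ->
    delta <= I (xi (g * exp (- s *: xi g))%g) (xi g).
  move=> /andP[s0 +]; rewrite le_min => /andP[stau _].
  have Bg : B (exp (- s *: xi g)).
    have -> : - s *: xi g = s *: - xi g by rewrite scaleNr scalerN.
    by apply: tauB; [near: g|rewrite s0].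
  have Ag : A g by near: g.
  exact: (AB (g, exp (- s *: xi g)) (conj Ag Bg)).
split; last exact: decay.
(* At time 0, a zero left gradient would give [delta <= 0]. *)
apply/eqP => xig; have := decay 0.
rewrite lexx le_min ltW//= divr_ge0// => /(_ isT).
by rewrite xig linear0r leNgt delta0.
Unshelve. all: by end_near. Qed.

Lemma eg_step_decrease h : xi h != 0 ->
  exists2 d : R, 0 < d & \forall g \near h,
    forall t0, v (eg_step I exp v (g, t0)).1 <= v g - d.
Proof.
move=> /left_gradient_decay[tau [delta [tauI delta0 decay]]].
have /andP[tau0 _] := tauI.
exists (delta * tau); first exact: mulr_gt0.
apply: filterS decay => g [xig decay] t0; rewrite /eg_step /= (negPf xig) /=.
have := @decrease_until_sup _ _ _ t0 (eg_curve_is_derive g t0) tau delta tauI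
  (ltW delta0).
rewrite /= eg_curve_start; apply => t /andP[t0t tt].
rewrite lerN2; apply: decay.
by rewrite subr_ge0 t0t lerBlDl.
Qed.

End ExpGradientStep.

(** * Convergence of the points of the flow and stopping of the algorithm *)

Section ExpGradientSequence.
Variables (R : realType) (n : nat) (G : lieGroupType R n).
Variable I : {dot 'rV[R]_n for idfun}.
Variables (exp : 'rV[R]_n -> G) (hexp : is_lie_exp exp).
Variables (v : G -> R) (hv : C1 v).
Variables (b : R) (gs : G) (hH1 : hypothesis_H1 v b gs).
Hypothesis hgs :
  forall g, sublevel v b g -> gradient_norm I v g = 0 -> g = gs.
Variables (g0 : G) (hg0 : sublevel v b g0).

Local Notation xi := (left_gradient I v).
Local Notation x := (eg_point I exp v g0).

(** The start time is left existential because the estimates on a step hold for every start time. *)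
Lemma eg_point_step k : exists t0, x k.+1 = (eg_step I exp v (x k, t0)).1.
Proof.
exists (eg_time I exp v g0 k).
by rewrite /eg_point /eg_time iterS -surjective_pairing.
Qed.

Lemma eg_point_nonincreasing j k : (j <= k)%N -> v (x k) <= v (x j).
Proof.
elim: k => [|k IH]; first by rewrite leqn0 => /eqP ->.
rewrite leq_eqVlt => /predU1P[-> //|/IH]; apply: le_trans.
by have [t0 ->] := eg_point_step k; exact: eg_step_le.
Qed.

Lemma eg_point_sublevel k : sublevel v b (x k).
Proof. exact: le_lt_trans (eg_point_nonincreasing (leq0n k)) hg0. Qed.

Lemma left_gradient_eq0_gs g : sublevel v b g -> xi g = 0 -> g = gs.
Proof.
move=> bg xig; apply: hgs => //; apply/eqP.
by rewrite gradient_norm_eq0 xig.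
Qed.

Lemma cluster_eg_point_le h k : cluster (x @ \oo) h -> v h <= v (x k).
Proof.
move=> clh; rewrite leNgt; apply/negP => vh.
have Fk : (x @ \oo) [set g | v g <= v (x k)].
  by exists k => // j /= kj; exact: eg_point_nonincreasing.
have Nh : nbhs h [set g | v (x k) < v g].
  by apply: (cvgr_gt _ (v_continuous hv (x := h))).
have [g [/= + vg]] := clh _ _ Fk Nh.
by rewrite leNgt vg.
Qed.

(** Otherwise let [d] be the fixed decrease near [h]. Some [x j] near [h] has value below [v h + d],
    so [v (x j.+1) < v h], against [cluster_eg_point_le]. *)
Lemma cluster_eg_point_eq0 h : cluster (x @ \oo) h -> xi h = 0.
Proof.
move=> clh; apply/eqP/negP => /negP xih.
have [d d0 dec] := eg_step_decrease hexp hv xih.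
have Nh : \forall g \near h, v g < v h + d.
  by apply: (cvgr_lt _ (v_continuous hv (x := h))); rewrite ltrDl.
have Fx : (x @ \oo) (range x) by exists 0%N => // k _; exists k.
have [_ [[j _ <-] [decj vj]]] := clh _ _ Fx (filterI dec Nh).
have [t0 E] := eg_point_step j.
have := cluster_eg_point_le j.+1 clh; rewrite leNgt E.
by rewrite (le_lt_trans (decj t0))// ltrBlDr.
Qed.

Lemma cluster_eg_point : cluster (x @ \oo) = [set gs].
Proof.
have clE h : cluster (x @ \oo) h -> h = gs.
  move=> clh; apply: left_gradient_eq0_gs; last exact: cluster_eg_point_eq0.
  (* A priori [h] is only in the closure of the sublevel set; the bound by the value at [g0] puts it
     inside, where [hgs] applies. *)
  exact: le_lt_trans (cluster_eg_point_le 0 clh) hg0.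
have [_ [_ _ _ cK _]] := hH1.
have [|h [_ clh]] := cK (x @ \oo) _.
  by exists 0%N => // k _; apply: subset_closure; exact: eg_point_sublevel.
by apply/seteqP; split => [g /clE //|_ ->]; rewrite -(clE h).
Qed.

Lemma eg_point_cvg : x k @[k --> \oo] --> gs.
Proof.
have [_ [oN _ [bgs _ _] cK _]] := hH1.
apply: (compact_cluster_set1 (lie_hausdorff (s := G)) cK).
- apply: (filterS (@subset_closure _ _)).
  by apply: open_nbhs_nbhs.
- by exists 0%N => // k _; apply: subset_closure; exact: eg_point_sublevel.
- exact: cluster_eg_point.
Qed.

Lemma left_gradient_gs : xi gs = 0.
Proof. by apply: cluster_eg_point_eq0; rewrite cluster_eg_point. Qed.

Lemma left_gradient_sq_eg_point_cvg :
  left_gradient_sq I v (x k) @[k --> \oo] --> (0 : R).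
Proof.
have c i : xi (x k) 0 i @[k --> \oo] --> xi gs 0 i.
  exact: cvg_comp eg_point_cvg
    (@left_gradient_coord_continuous _ _ _ _ hexp I v hv i gs).
have := cvg_dot (I := I) c c; rewrite left_gradient_gs linear0r => sq0.
exact: sq0.
Qed.

Lemma eg_hmp_stops beta : 0 < beta ->
  exists k, eg_hmp_stops_at I exp v g0 beta k.
Proof.
move=> beta0.
have [N _ /(_ N (leqnn N)) small] : \forall k \near \oo,
    left_gradient_sq I v (x k) < beta.
  exact: (cvgr_lt _ left_gradient_sq_eg_point_cvg).
have ex : exists k, left_gradient_sq I v (x k) < beta by exists N.
exists (ex_minn ex); case: ex_minnP => k kb kmin; split => // j.
by rewrite ltnNge => /negP jk /kmin.
Qed.

Lemma eg_hmp_stops_unique beta j k : eg_hmp_stops_at I exp v g0 beta j ->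
  eg_hmp_stops_at I exp v g0 beta k -> j = k.
Proof.
move=> [jb jmin] [kb kmin]; apply/eqP; rewrite eqn_leq.
by apply/andP; split; rewrite leqNgt; apply/negP; [move/jmin|move/kmin]; apply.
Qed.

Lemma equilibrium_eg_flow k : xi (x k) = 0 ->
  eg_flow_reaches_equilibrium I exp v g0.
Proof.
move=> xik; exists k; split; first exact: left_gradient0_gradient0.
by move=> t kt; exists k; rewrite xik eqxx.
Qed.

(** It suffices that [beta] be below finitely many positive numbers, the nonzero squared norms among
    the first [N] points. *)
Lemma near0_no_early_stop N : \forall beta \near (0 : R)^'+,
  forall j, (j < N)%N -> xi (x j) != 0 -> beta <= left_gradient_sq I v (x j).
Proof.
elim: N => [|N IH]; first by apply: nearW.
have : \forall beta \near (0 : R)^'+,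
    xi (x N) != 0 -> beta <= left_gradient_sq I v (x N).
  have [_|xiN] := eqVneq (xi (x N)) 0; first by apply: nearW.
  near=> beta => _; near: beta; apply: nbhs_right_le.
  exact: neq0_dnorm_gt0.
apply: filterS2 IH => beta IH HN j; rewrite ltnS leq_eqVlt => /predU1P[->//|].
exact: IH.
Unshelve. all: by end_near. Qed.

End ExpGradientSequence.

Theorem theorem6 (R : realType) (n : nat) (G : lieGroupType R n)
    (I : {dot 'rV[R]_n for idfun})
    (exp : 'rV[R]_n -> G) (hexp : is_lie_exp exp)
    (v : G -> R) (hv : C1 v)
    (b : R) (gs : G) (hH1 : hypothesis_H1 v b gs)
    (hgs : forall g, sublevel v b g -> gradient_norm I v g = 0 -> g = gs)
    (g0 : G) (hg0 : sublevel v b g0) :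
  exists k : R -> nat,
    (forall beta : R, 0 < beta ->
       (forall j, eg_hmp_stops_at I exp v g0 beta j <-> j = k beta) /\
       ((0 < left_gradient_sq I v (eg_point I exp v g0 (k beta)) < beta) \/
        [/\ left_gradient_sq I v (eg_point I exp v g0 (k beta)) = 0,
            eg_flow_reaches_equilibrium I exp v g0,
            gradient I v (eg_point I exp v g0 (k beta)) = 0,
            eg_point I exp v g0 (k beta) = gs &
            forall g, sublevel v b g -> (gradient_norm I v g = 0 <-> g = gs)]))
    /\ eg_point I exp v g0 (k beta) @[beta --> 0^'+] --> gs
    /\ (~ eg_flow_reaches_equilibrium I exp v g0 ->
        k beta @[beta --> 0^'+] --> \oo).
Proof.
(* Positivity of [beta] is put under the existential so that choice yields a total function, with
   dummy value 0 where [beta <= 0]. *)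
have stops beta : exists k, 0 < beta -> eg_hmp_stops_at I exp v g0 beta k.
  have [/(eg_hmp_stops hexp hv hH1 hgs hg0)[k kP]|_] := ltP 0 beta.
    by exists k.
  by exists 0%N.
have [k kP] := choice stops; exists k.
have sublv j : sublevel v b (eg_point I exp v g0 j).
  exact: eg_point_sublevel.
(* For small [beta], a stop before index [N] can occur only at an equilibrium; both limits rest on
   this. *)
have early N : \forall beta \near (0 : R)^'+, (k beta < N)%N ->
    left_gradient I v (eg_point I exp v g0 (k beta)) = 0.
  near=> beta => kN; have beta0 : 0 < beta by near: beta; exact: nbhs_right_gt.
  have [kb _] := kP _ beta0; apply/eqP/negP => /negP xik.
  have H : forall j, (j < N)%N ->
      left_gradient I v (eg_point I exp v g0 j) != 0 ->
      beta <= left_gradient_sq I v (eg_point I exp v g0 j).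
    by near: beta; exact: near0_no_early_stop.
  by have := H _ kN xik; rewrite leNgt kb.
split; [move=> beta beta0; split|split].
- move=> j; split => [jP|->]; last exact: kP.
  exact: eg_hmp_stops_unique jP (kP _ beta0).
- have [kb _] := kP _ beta0.
  have [sq0|sq0] := eqVneq (left_gradient_sq I v (eg_point I exp v g0 (k beta))) 0.
    have xi0 : left_gradient I v (eg_point I exp v g0 (k beta)) = 0.
      by apply/eqP; rewrite -left_gradient_sq_eq0 sq0.
    right; split => //.
    + exact: equilibrium_eg_flow xi0.
    + exact: left_gradient0_gradient0.
    + exact: left_gradient_eq0_gs hgs _ (sublv _) xi0.
    + move=> g bg; split => [|->]; first exact: hgs.
      apply/eqP; rewrite gradient_norm_eq0.
      by rewrite (left_gradient_gs hexp hv hH1 hgs hg0).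
  left; rewrite kb andbT lt_neqAle eq_sym sq0; exact: dot_ge0.
(* Either [k beta] lies in the tail of the sequence contained in [U], or the stop is at an
   equilibrium, which is [gs] itself. *)
- move=> U Ugs.
  have [N _ NU] := eg_point_cvg hexp hv hH1 hgs hg0 Ugs.
  have := early N; apply: filterS => beta kN /=.
  have [/kN xi0|] := ltnP (k beta) N; last exact: NU.
  rewrite (left_gradient_eq0_gs hgs (sublv _) xi0).
  exact: nbhs_singleton.
(* Here an early stop is excluded altogether, since it would make the flow reach an equilibrium. *)
- move=> noeq U [N _ NU].
  have := early N; apply: filterS => beta kN /=.
  have [/kN xi0|] := ltnP (k beta) N; last exact: NU.
  by have := noeq (equilibrium_eg_flow xi0).
Unshelve. all: by end_near. Qed.
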